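(* Let $N\geq 2$, $\hbar = 2/\sqrt{N^2-1}$ and $\kappa\geq 0$, and let $f\colon\mathbb{R}\to\mathbb{R}$ be a convex function. Let $W=W(t)\in\mathfrak{su}(N)$ be a solution of the Euler--Zeitlin equations with canonical dissipation $$\dot W + \frac{1}{\hbar}[W,P] = \frac{\kappa}{\hbar^2}[[W,P],P],\qquad -\Delta_N P = W,$$ where $P=P(t)\in\mathfrak{su}(N)$ and $\Delta_N$ is the quantized Laplacian. Then the Casimir $$C_f^N(W)=\frac{4\pi}{N}\operatorname{tr}\big(f(\mathrm{i}W)\big)$$ decays along the solution, i.e. $t\mapsto C_f^N(W(t))$ is non-increasing.
   Context: $\mathfrak{u}(N)$ is the space of skew-Hermitian complex $N\times N$ matrices, $\mathfrak{su}(N)$ its subspace of trace-free matrices, and $[A,B]=AB-BA$. For $W\in\mathfrak{u}(N)$ the matrix $\mathrm{i}W$ is Hermitian, and $f(\mathrm{i}W)$ is defined by functional calculus (apply $f$ to the eigenvalues). Let $S_1,S_2,S_3\in\mathfrak{u}(N)$ be the generators of the irreducible $N$-dimensional unitary representation of $\mathfrak{so}(3)$, so $[S_1,S_2]=S_3$, $[S_2,S_3]=S_1$, $[S_3,S_1]=S_2$. The quantized (Hoppe--Yau) Laplacian is $$\Delta_N\colon\mathfrak{u}(N)\to\mathfrak{su}(N),\qquad \Delta_N P=\sum_{\alpha=1}^3[[P,S_\alpha],S_\alpha].$$ Its spectrum is $\{-\ell(\ell+1):\ell=0,\dots,N-1\}$ and its kernel is spanned by $\mathrm{i}I$, so that $\Delta_N$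 restricts to an invertible operator on $\mathfrak{su}(N)$, and $P\in\mathfrak{su}(N)$ is uniquely determined by $W\in\mathfrak{su}(N)$ via $-\Delta_N P=W$. *)

(* Defs.v *)
From mathcomp Require Import all_boot all_order all_algebra.
From mathcomp Require Import sesquilinear spectral.
From mathcomp Require Import complex.
From mathcomp Require Import all_classical all_reals all_analysis.

Set Implicit Arguments.
Unset Strict Implicit.
Unset Printing Implicit Defensive.

Import Order.TTheory GRing.Theory Num.Theory.
Import numFieldNormedType.Exports.
Local Open Scope classical_set_scope.
Local Open Scope complex_scope.
Local Open Scope ring_scope.

Definition bracket (C : pzRingType) (N : nat) (A B : 'M[C]_N) : 'M[C]_N :=
  A *m B - B *m A.

(* [hermitianmx _ true conjC] reads [A = - A^t*]. *)
Definition in_u (C : numClosedFieldType) (N : nat) (A : 'M[C]_N) : Prop :=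
  A \is hermitianmx N true Num.conj.

Definition in_su (C : numClosedFieldType) (N : nat) (A : 'M[C]_N) : Prop :=
  in_u A /\ \tr A = 0.

(* Matrices act on column vectors, whereas subspaces are row spaces in
   mxalgebra: [stablemx U (S a)^T] says that the span of the transposed rows
   of [U] is mapped into itself by [S a]. *)
Definition irreducible_family (C : fieldType) (N : nat) (I : finType)
    (S : I -> 'M[C]_N) : Prop :=
  (0 < N)%N /\
  forall U : 'M[C]_N, (forall a, stablemx U (S a)^T) -> U = 0 \/ row_full U.

(* Indices are in 'I_3 = {0, 1, 2}, with S 0, S 1, S 2 standing for S_1, S_2,
   S_3; a Lie-algebra representation of so(3) is the same as three matrices
   with these commutators. *)
Definition so3_irrep (C : numClosedFieldType) (N : nat)
    (S : 'I_3 -> 'M[C]_N) : Prop :=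
  [/\ forall a, in_u (S a),
      [/\ bracket (S 0) (S 1) = S 2%:R,
          bracket (S 1) (S 2%:R) = S 0
        & bracket (S 2%:R) (S 0) = S 1]
    & irreducible_family S].

Definition quantized_laplacian (C : pzRingType) (N : nat)
    (S : 'I_3 -> 'M[C]_N) (P : 'M[C]_N) : 'M[C]_N :=
  \sum_(a < 3) bracket (bracket P (S a)) (S a).

(* Functional calculus, for Hermitian [A]: the eigenvalues [spectral_diag A]
   are then real, so that taking [complex.Re] loses nothing. *)
Definition herm_fun (R : realType) (N : nat) (f : R -> R)
    (A : 'M[R[i]]_N) : 'M[R[i]]_N :=
  invmx (spectralmx A)
    *m diag_mx (map_mx (fun z => (f (complex.Re z))%:C) (spectral_diag A))
    *m spectralmx A.

(* For [W] in u(N) this complex number is real. In R[i], [x <= y] means that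
   [x] and [y] have the same imaginary part and [Re x <= Re y]. *)
Definition casimir (R : realType) (N : nat) (f : R -> R)
    (W : 'M[R[i]]_N) : R[i] :=
  (4 * pi / N%:R)%:C * \tr (herm_fun f ('i%C *: W)).

(* Continuity and differentiability of curves of complex matrices with respect
   to the real variable, through the real and imaginary parts of the entries. *)
Definition mx_continuous_within (R : realType) (N : nat) (D : set R)
    (W : R -> 'M[R[i]]_N) : Prop :=
  forall i j,
    {within D, continuous (fun s => complex.Re (W s i j) : R)} /\
    {within D, continuous (fun s => complex.Im (W s i j) : R)}.

Definition mx_derivable (R : realType) (N : nat)
    (W : R -> 'M[R[i]]_N) (t : R) : Prop :=
  forall i j,
    derivable (fun s => complex.Re (W s i j) : R) t 1 /\
    derivable (fun s => complex.Im (W s i j) : R) t 1.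

Definition mx_derive (R : realType) (N : nat)
    (W : R -> 'M[R[i]]_N) (t : R) : 'M[R[i]]_N :=
  \matrix_(i, j) (derive1 (fun s => complex.Re (W s i j) : R) t
                  +i* derive1 (fun s => complex.Im (W s i j) : R) t).

Definition hbar (R : realType) (N : nat) : R := 2 / Num.sqrt (N%:R ^+ 2 - 1).

(* The time domain is an arbitrary interval [J] with or without its endpoints;
   at an endpoint only continuity of [W] is required, which one-sided
   differentiability there would imply. *)
Definition euler_zeitlin_solution (R : realType) (N : nat)
    (S : 'I_3 -> 'M[R[i]]_N) (kappa : R) (J : interval R)
    (W P : R -> 'M[R[i]]_N) : Prop :=
  [/\ forall t, t \in J ->
        [/\ in_su (W t), in_su (P t) & - quantized_laplacian S (P t) = W t],
      mx_continuous_within [set` J] W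
    & forall t, [set` J]^° t ->
        mx_derivable W t /\
        mx_derive W t + ((hbar R N)^-1)%:C *: bracket (W t) (P t) =
          (kappa / hbar R N ^+ 2)%:C *: bracket (bracket (W t) (P t)) (P t)].

(* Main.v *)
(** Let A = iW, let g be a subgradient of f, and put phi(A) = tr f(A).
    Klein's inequality phi(B) >= phi(A) + Re tr(g(A) (B - A)) holds for
    Hermitian A and B without any smoothness of f. Taken at A = A(t), B = A(s)
    with s < t, it bounds the left upper Dini derivative of phi along the
    solution by Re tr(g(A) A'). There the transport term tr(g(A) [A, P])
    vanishes, and the dissipative term Re tr(g(A) [[A, P], P]) is nonpositive
    because g is nondecreasing. Klein's inequality also makes phi locally
    Lipschitz, and a continuous function whose left upper Dini derivative is
    nonpositive in the interior of an interval is nonincreasing. *)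
Require Import Defs.
From mathcomp Require Import all_boot all_order all_algebra.
From mathcomp Require Import sesquilinear spectral complex.
From mathcomp Require Import all_classical all_reals all_analysis.
From mathcomp Require Import ring lra.

Set Implicit Arguments.
Unset Strict Implicit.
Unset Printing Implicit Defensive.

Import Order.TTheory GRing.Theory Num.Theory.
Import numFieldNormedType.Exports.
Local Open Scope classical_set_scope.
Local Open Scope complex_scope.
Local Open Scope convex_scope.
Local Open Scope sesquilinear_scope.
Local Open Scope ring_scope.

(** * Subgradients of convex functions on the real line *)

Lemma convex_slope_le (R : realType) (f : R -> R)
    (hf : convex_function (E := R^o) setT f) (x y z : R) :
  y < x -> x < z -> (f x - f y) / (x - y) <= (f z - f x) / (z - x).
Proof.
move=> yx xz.
have yz : y < z by exact: lt_trans xz.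
(* [x] is the convex combination of [y] and [z] with weight [(z - x) / (z - y)] on [y]. *)
have t0 : 0 <= (z - x) / (z - y) by rewrite divr_ge0// subr_ge0 ltW.
have t1 : (z - x) / (z - y) <= 1.
  by rewrite ler_pdivrMr ?subr_gt0// mul1r lerB// ltW.
have zy0 : z - y != 0 by rewrite subr_eq0 gt_eqF.
have h : f ((z - x) / (z - y) * y + (1 - (z - x) / (z - y)) * z)
    <= (z - x) / (z - y) * f y + (1 - (z - x) / (z - y)) * f z.
  exact: hf (Itv01 t0 t1) y z (in_setT y) (in_setT z).
have {}h : f x <= (z - x) / (z - y) * f y + (1 - (z - x) / (z - y)) * f z.
  apply: le_trans h; rewrite le_eqVlt; apply/orP; left; apply/eqP.
  by congr f; field.
rewrite ler_pdivrMr ?subr_gt0// mulrAC ler_pdivlMr ?subr_gt0//.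
have : f x * (z - y) <= f y * (z - x) + f z * (x - y).
  rewrite -ler_pdivlMr ?subr_gt0//; apply: (le_trans h).
  by rewrite le_eqVlt; apply/orP; left; apply/eqP; field.
nra.
Qed.

Definition subgradient (R : realType) (f g : R -> R) :=
  forall x y, f x + g x * (y - x) <= f y.

(** The left derivative serves: at each [x] it is the supremum of the slopes to the left, a set
    bounded above by every slope to the right. Choice then collects these numbers into a function
    [g]. *)
Lemma convex_subgradient (R : realType) (f : R -> R) :
  convex_function (E := R^o) setT f -> exists g, subgradient f g.
Proof.
move=> hf.
suff H x : exists m, forall y, f x + m * (y - x) <= f y.
  have [g hg] := choice H; by exists g.
pose S := [set (f x - f y) / (x - y) | y in [set y | y < x]].
have S0 : S !=set0.
  by exists ((f x - f (x - 1)) / (x - (x - 1))), (x - 1) => //=; lra.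
have ubS z : x < z -> ubound S ((f z - f x) / (z - x)).
  by move=> xz _ [y /= yx <-]; exact: convex_slope_le.
have supS : has_sup S.
  by split => //; exists ((f (x + 1) - f x) / (x + 1 - x)); apply: ubS; lra.
exists (sup S) => y.
have [yx|xy|->] := ltgtP y x; last by rewrite subrr mulr0 addr0.
- have : (f x - f y) / (x - y) <= sup S.
    by apply: ub_le_sup; [case: supS|exists y].
  rewrite ler_pdivrMr ?subr_gt0//; nra.
- have : sup S <= (f y - f x) / (y - x) by apply: ge_sup => //; exact: ubS.
  rewrite ler_pdivlMr ?subr_gt0//; nra.
Qed.

Lemma subgradient_nondecreasing (R : realType) (f g : R -> R) x y :
  subgradient f g -> 0 <= (g x - g y) * (x - y).
Proof. by move=> h; have := h x y; have := h y x; nra. Qed.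

(** [g] may jump but is monotone, so on [[-M, M]] it lies between [g (- M)] and [g M]. This gives
    one constant for all matrices with spectrum in that interval. *)
Lemma subgradient_bounded (R : realType) (f g : R -> R) (M : R) x :
  subgradient f g -> `|x| <= M -> `|g x| <= `|g (- M)| + `|g M|.
Proof.
move=> h; rewrite ler_norml => /andP[Mx xM].
have hmono u v : u <= v -> g u <= g v.
  rewrite le_eqVlt => /predU1P[->//|uv].
  by have := subgradient_nondecreasing u v h;
    rewrite nmulr_lge0 ?subr_lt0// subr_le0.
have := hmono _ _ Mx; have := hmono _ _ xM.
have := ler_norm (g M); have := ler_norm (- g (- M)); rewrite normrN.
have := normr_ge0 (g M); have := normr_ge0 (g (- M)).
rewrite ler_norml; lra.
Qed.

(** * Trace identities for commutators *)

Lemma bracketZl (K : comPzRingType) n (k : K) (A B : 'M[K]_n) :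
  bracket (k *: A) B = k *: bracket A B.
Proof. by rewrite /bracket -scalemxAl -scalemxAr scalerBr. Qed.

Lemma mxtrace_comm_bracket (K : comPzRingType) n (G A P : 'M[K]_n) :
  comm_mx A G -> \tr (G *m bracket A P) = 0.
Proof.
move=> AG; rewrite mulmxBr raddfB/= !mulmxA -AG.
by rewrite -!mulmxA mxtrace_mulC !mulmxA subrr.
Qed.

(** The scalar [z] passes from [G] to [X]; the single bracket then drops out, because [G] commutes
    with [z *: X] and the trace is cyclic. *)
Lemma mxtrace_mul_double_bracketB (K : comPzRingType) n (k l z : K)
    (G X Q : 'M[K]_n) :
  comm_mx (z *: X) G ->
  \tr ((z *: G) *m (k *: bracket (bracket X Q) Q - l *: bracket X Q)) =
  k * \tr (G *m bracket (bracket (z *: X) Q) Q).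
Proof.
move=> /mxtrace_comm_bracket => /(_ Q); rewrite !bracketZl.
rewrite -scalemxAr mxtraceZ => XG0.
by rewrite mulmxBr -!scalemxAl -!scalemxAr raddfB/= !mxtraceZ
  [_ * (l * _)]mulrCA XG0; ring.
Qed.

Lemma mxtrace_mulZB (K : comPzRingType) n (z : K) (G X Y : 'M[K]_n) :
  \tr (G *m (z *: X - z *: Y)) = \tr ((z *: G) *m X) - \tr ((z *: G) *m Y).
Proof. by rewrite mulmxBr -!scalemxAr -!scalemxAl raddfB. Qed.

(** * Trace inequalities for unitarily diagonalized matrices *)

Section UnitaryConj.
Variables (C : numClosedFieldType) (n : nat).
Implicit Types (A B G P U V Q X Y : 'M[C]_n) (a b c : 'rV[C]_n).

Lemma unitary_conjM U X Y : U \is unitarymx ->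
  (U^t* *m X *m U) *m (U^t* *m Y *m U) = U^t* *m (X *m Y) *m U.
Proof.
move=> /unitarymxP hU.
by rewrite !mulmxA -(mulmxA _ U) hU mulmx1.
Qed.

Lemma mxtrace_unitary_conj U X : U \is unitarymx ->
  \tr (U^t* *m X *m U) = \tr X.
Proof. by move=> /unitarymxP hU; rewrite mxtrace_mulC mulmxA hU mul1mx. Qed.

Lemma unitarymx_row_norm U i : U \is unitarymx -> \sum_j `|U i j| ^+ 2 = 1.
Proof.
move=> /unitarymxP/matrixP/(_ i i); rewrite !mxE eqxx => h; rewrite -[RHS]h.
by apply: eq_bigr => j _; rewrite !mxE normCK.
Qed.

Lemma unitarymx_col_norm U j : U \is unitarymx -> \sum_i `|U i j| ^+ 2 = 1.
Proof.
rewrite -trmxC_unitary => /(unitarymx_row_norm j) <-.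
by apply: eq_bigr => i _; rewrite !mxE norm_conjC.
Qed.

Lemma unitarymx_norm_le1 U i j : U \is unitarymx -> `|U i j| <= 1.
Proof.
move=> /(unitarymx_row_norm i) h.
rewrite -(@expr_le1 _ 2)// -h (bigD1 j)//= lerDl.
by apply: sumr_ge0 => k _; rewrite exprn_ge0.
Qed.

Lemma unitary_conj_diag_norm_le U X i : U \is unitarymx ->
  `|(U *m X *m U^t*) i i| <= \sum_j \sum_k `|X j k|.
Proof.
move=> hU; rewrite exchange_big/= mxE.
apply: le_trans (ler_norm_sum _ _ _) _; apply: ler_sum => k _.
rewrite mxE normrM !mxE norm_conjC -[leRHS]mulr1.
apply: ler_pM; rewrite ?unitarymx_norm_le1//.
apply: le_trans (ler_norm_sum _ _ _) _; apply: ler_sum => j _.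
by rewrite normrM ler_piMl// unitarymx_norm_le1.
Qed.

Lemma mxtrace_diag_conj a b Q :
  \tr (diag_mx a *m Q *m diag_mx b *m Q^t*) =
  \sum_i \sum_j a 0 i * b 0 j * `|Q i j| ^+ 2.
Proof.
rewrite /mxtrace; apply: eq_bigr => i _; rewrite mxE; apply: eq_bigr => j _.
by rewrite mul_mx_diag mul_diag_mx !mxE normCK; ring.
Qed.

(* With [p_ij = |(U V^-1)_ij|^2], which is doubly stochastic, the difference of
   the two sides is [sum_(i, j) p_ij (chi_j - phi_i - c_i (b_j - a_i))]. *)
Lemma peierls_klein A B G U V a b c (phi chi : 'I_n -> C) :
  U \is unitarymx -> V \is unitarymx ->
  A = U^t* *m diag_mx a *m U -> B = V^t* *m diag_mx b *m V ->
  G = U^t* *m diag_mx c *m U ->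
  (forall i j, phi i + c 0 i * (b 0 j - a 0 i) <= chi j) ->
  \sum_i phi i + \tr (G *m (B - A)) <= \sum_i chi i.
Proof.
move=> hU hV -> -> -> hphi.
pose Q := U *m V^t*.
have hQ : Q \is unitarymx by rewrite mul_unitarymx ?trmxC_unitary.
have QtE : Q^t* = V *m U^t* by rewrite trmx_mul map_mxM trmxCK.
rewrite mulmxBr raddfB/= unitary_conjM// mxtrace_unitary_conj// mulmx_diag.
rewrite mxtrace_diag.
have -> : \tr ((U^t* *m diag_mx c *m U) *m (V^t* *m diag_mx b *m V)) =
    \sum_i \sum_j c 0 i * b 0 j * `|Q i j| ^+ 2.
  by rewrite -mxtrace_diag_conj QtE !mulmxA [RHS]mxtrace_mulC !mulmxA.
have rowE (F : 'I_n -> C) : \sum_i F i = \sum_i \sum_j F i * `|Q i j| ^+ 2.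
  by apply: eq_bigr => i _; rewrite -mulr_sumr unitarymx_row_norm// mulr1.
have -> : \sum_i chi i = \sum_j \sum_i chi i * `|Q j i| ^+ 2.
  rewrite exchange_big; apply: eq_bigr => i _.
  by rewrite -mulr_sumr unitarymx_col_norm// mulr1.
rewrite (rowE phi) [X in _ - X]rowE.
rewrite -sumrB -big_split/=; apply: ler_sum => i _.
rewrite -sumrB -big_split/=; apply: ler_sum => j _.
rewrite -mulrBl -mulrDl ler_wpM2r ?exprn_ge0// mxE.
by rewrite -mulrBr hphi.
Qed.

Lemma unitary_conj_diagC U a c : U \is unitarymx ->
  comm_mx (U^t* *m diag_mx a *m U) (U^t* *m diag_mx c *m U).
Proof. by move=> hU; rewrite /comm_mx !unitary_conjM// diag_mxC. Qed.

(* The trace is [- sum_(i, j) (c_i - c_j) (a_i - a_j) |p_ij|^2], where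
   [p = U P U^-1]. *)
Lemma mxtrace_double_bracket_le0 A G P U a c :
  U \is unitarymx -> A = U^t* *m diag_mx a *m U -> G = U^t* *m diag_mx c *m U ->
  in_u P -> (forall i j, 0 <= (c 0 i - c 0 j) * (a 0 i - a 0 j)) ->
  \tr (G *m bracket (bracket A P) P) <= 0.
Proof.
move=> hU AE GE /is_hermitianmxP; rewrite expr1 scaleN1r => hP hca.
pose p := U *m P *m U^t*.
have pE : p = - p^t*.
  rewrite /p !(trmx_mul, map_mxM) trmxCK mulmxA.
  by rewrite {1}hP mulmxN mulNmx.
have trE (x y : 'rV_n) :
   \tr ((U^t* *m diag_mx x *m U) *m P *m (U^t* *m diag_mx y *m U) *m P) =
   - \sum_i \sum_j x 0 i * y 0 j * `|p i j| ^+ 2.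
  rewrite -mxtrace_diag_conj -raddfN -mulmxN -pE /p.
  by rewrite !mulmxA [RHS]mxtrace_mulC !mulmxA.
clear hP.
have GAE : G *m A = U^t* *m diag_mx (\row_i (c 0 i * a 0 i)) *m U.
  by rewrite AE GE unitary_conjM// mulmx_diag.
have AGC : A *m G = G *m A by rewrite AE GE; exact: unitary_conj_diagC.
have oneE : 1%:M = U^t* *m diag_mx (const_mx 1) *m U.
  by rewrite diag_const_mx mulmx1; have /unitarymxP/mulmx1C -> := hU.
(* The two outer terms of the double bracket have the same trace since [A] and [G] commute. The
   factor [1%:M], diagonal in the same basis, brings both remaining terms to the shape of [trE]. *)
have -> : \tr (G *m bracket (bracket A P) P) =
   \tr ((G *m A) *m P *m 1%:M *m P) *+ 2 - \tr (G *m P *m A *m P) *+ 2.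
  rewrite /bracket !(mulmxBl, mulmxBr) !(raddfB, raddfD)/= !mulmx1.
  have -> : \tr (G *m (P *m (P *m A))) = \tr (G *m (A *m P *m P)).
    by rewrite mulmxA mulmxA mxtrace_mulC !mulmxA AGC.
  by rewrite !mulmxA !mulr2n; ring.
rewrite GAE oneE [in X in _ - X]GE [in X in _ - X]AE !trE.
rewrite !mulNrn opprK addrC subr_le0 -subr_ge0.
have pC i j : `|p i j| = `|p j i| by rewrite {1}pE !mxE normrN norm_conjC.
rewrite -mulrnBl -sumrB mulr2n.
under eq_bigr do rewrite -sumrB.
(* Exchanging [i] and [j] in the second of two equal copies symmetrizes the summand into
   [(c_i - c_j) (a_i - a_j) |p_ij|^2]. *)
rewrite {2}exchange_big -big_split/=; apply: sumr_ge0 => i _.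
rewrite -big_split/=; apply: sumr_ge0 => j _.
clearbody p; rewrite (pC j i) !mxE.
have := mulr_ge0 (hca i j) (exprn_ge0 2 (normr_ge0 (p i j))).
by congr (0 <= _); ring.
Qed.

(** By cyclicity the trace is the sum of [c_i] times the [i]-th diagonal entry of [U X U^t*], and
    each of these [n] entries is at most the entrywise l1 norm of [X]. *)
Lemma mxtrace_unitary_conj_norm_le U c X (K : C) :
  U \is unitarymx -> (forall i, `|c 0 i| <= K) ->
  `|\tr (U^t* *m diag_mx c *m U *m X)| <= n%:R * K * \sum_i \sum_j `|X i j|.
Proof.
move=> hU hc; rewrite -!mulmxA mxtrace_mulC -!mulmxA.
apply: le_trans (ler_norm_sum _ _ _) _.
have -> : n%:R * K * (\sum_i \sum_j `|X i j|) =
    \sum_(k < n) K * \sum_i \sum_j `|X i j|.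
  by rewrite sumr_const card_ord -mulrA mulr_natl.
apply: ler_sum => i _.
rewrite mul_diag_mx mxE normrM ler_pM//.
by rewrite mulmxA unitary_conj_diag_norm_le.
Qed.

End UnitaryConj.

(** * Eigenvalues and functional calculus of Hermitian matrices *)

Lemma Re_normE (R : rcfType) (z : R[i]) : (complex.Re `|z|)%:C = `|z|.
Proof. by apply: RRe_real; exact: normr_real. Qed.

Section Eigenvalues.
Variables (R : realType) (n : nat).
Implicit Types (A B P X : 'M[R[i]]_n) (f g : R -> R).

Definition eigval A (i : 'I_n) : R := complex.Re (spectral_diag A 0 i).

Definition trfun f A : R := \sum_i f (eigval A i).

(** The entrywise l1 norm. The modulus in [R[i]] is itself a complex number with zero imaginary
    part, and [complex.Re] only brings it into [R]. *)
Definition norm1 X : R := \sum_i \sum_j complex.Re `|X i j|.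

Lemma norm1E X : (norm1 X)%:C = \sum_i \sum_j `|X i j|.
Proof.
rewrite rmorph_sum; apply: eq_bigr => i _.
rewrite rmorph_sum; apply: eq_bigr => j _.
exact: Re_normE.
Qed.

Lemma herm_funE f A : herm_fun f A = (spectralmx A)^t*
  *m diag_mx (\row_i (f (eigval A i))%:C) *m spectralmx A.
Proof.
have sdE : map_mx (fun z => (f (complex.Re z))%:C) (spectral_diag A) =
    \row_i (f (eigval A i))%:C by apply/rowP => i; rewrite !mxE.
by rewrite /herm_fun sdE (invmx_unitary (spectral_unitarymx A)).
Qed.

Lemma spectral_diagE A : A \is hermsymmx ->
  spectral_diag A = \row_i (eigval A i)%:C.
Proof.
move=> hA; apply/rowP => i; rewrite mxE RRe_real//.
by have /mxOverP := hermitian_spectral_diag_real hA; exact.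
Qed.

Lemma herm_eigenbasis A : A \is hermsymmx -> A = (spectralmx A)^t*
  *m diag_mx (\row_i (eigval A i)%:C) *m spectralmx A.
Proof.
move=> hA; have /orthomx_spectralP := hermitian_normalmx hA.
by rewrite (invmx_unitary (spectral_unitarymx A)) spectral_diagE.
Qed.

Lemma mxtrace_herm_fun f A : \tr (herm_fun f A) = (trfun f A)%:C.
Proof.
rewrite herm_funE (mxtrace_unitary_conj _ (spectral_unitarymx A)) mxtrace_diag.
by rewrite rmorph_sum; apply: eq_bigr => i _; rewrite mxE.
Qed.

(** This is [peierls_klein] with [c_i = g(a_i)], where its scalar hypothesis becomes the subgradient
    inequality between an eigenvalue of [A] and one of [B]. *)
Lemma klein f g A B : subgradient f g ->
  A \is hermsymmx -> B \is hermsymmx ->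
  trfun f A + complex.Re (\tr (herm_fun g A *m (B - A))) <= trfun f B.
Proof.
move=> fg hA hB.
pose phi i := (f (eigval A i))%:C; pose chi i := (f (eigval B i))%:C.
have := @peierls_klein _ _ _ _ _ _ _ _ _ _ phi chi (spectral_unitarymx A)
  (spectral_unitarymx B) (herm_eigenbasis hA) (herm_eigenbasis hB)
  (herm_funE g A).
have h i j : phi i + (\row_i (g (eigval A i))%:C) 0 i *
   ((\row_i (eigval B i)%:C) 0 j - (\row_i (eigval A i)%:C) 0 i) <= chi j.
  by rewrite !mxE -rmorphB -rmorphM -rmorphD/= lecR.
move=> /(_ h); rewrite /phi /chi -!rmorph_sum lecE => /andP[_].
by rewrite raddfD.
Qed.

Lemma mxtrace_herm_double_bracket_le0 g A P :
  (forall x y, 0 <= (g x - g y) * (x - y)) -> A \is hermsymmx -> in_u P ->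
  complex.Re (\tr (herm_fun g A *m bracket (bracket A P) P)) <= 0.
Proof.
move=> hg hA hP.
have := mxtrace_double_bracket_le0 (spectral_unitarymx A) (herm_eigenbasis hA)
  (herm_funE g A) hP.
have h i j : 0 <=
    ((\row_i (g (eigval A i))%:C) 0 i - (\row_i (g (eigval A i))%:C) 0 j) *
    ((\row_i (eigval A i)%:C) 0 i - (\row_i (eigval A i)%:C) 0 j) :> R[i].
  by rewrite !mxE -!rmorphB -rmorphM/= ler0c.
by move=> /(_ h); rewrite lecE => /andP[_].
Qed.

Lemma herm_fun_comm g A : A \is hermsymmx -> comm_mx A (herm_fun g A).
Proof.
move=> hA; rewrite herm_funE [X in comm_mx X](herm_eigenbasis hA).
exact: unitary_conj_diagC (spectral_unitarymx A).
Qed.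

(** An eigenvalue is a diagonal entry of [A] conjugated into its eigenbasis. *)
Lemma eigval_le_norm1 A i : A \is hermsymmx -> `|eigval A i| <= norm1 A.
Proof.
move=> hA; rewrite -lecR norm1E.
have <- : `|(eigval A i)%:C| = `|eigval A i|%:C.
  by rewrite normc_def/= expr0n addr0 sqrtr_sqr.
have := unitary_conj_diag_norm_le A i (spectral_unitarymx A).
congr (`|_| <= _).
rewrite [X in _ *m X *m _](herm_eigenbasis hA).
have /unitarymxP hU := spectral_unitarymx A.
by rewrite !mulmxA hU mul1mx -mulmxA hU mulmx1 !mxE eqxx.
Qed.

(** Klein's inequality at [A] bounds the difference by [Re tr(g(A) (A - B))]. Exchanging [A] and [B]
    gives the reverse bound, hence a local Lipschitz estimate. *)
Lemma trfun_le f g (K : R) A B : subgradient f g ->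
  (forall i, `|g (eigval A i)| <= K) -> A \is hermsymmx -> B \is hermsymmx ->
  trfun f A - trfun f B <= n%:R * K * norm1 (A - B).
Proof.
move=> fg hK hA hB.
have := klein fg hA hB.
have := @mxtrace_unitary_conj_norm_le _ _ _ (\row_i (g (eigval A i))%:C)
  (A - B) K%:C (spectral_unitarymx A).
rewrite -herm_funE -norm1E -[n%:R](rmorph_nat (real_complex R)) -!rmorphM/=.
have h i : `|(\row_i (g (eigval A i))%:C) 0 i| <= K%:C :> R[i].
  by rewrite mxE normc_def/= expr0n addr0 sqrtr_sqr lecR.
move=> /(_ h) hle hk.
have : complex.Re (\tr (herm_fun g A *m (A - B))) <= n%:R * K * norm1 (A - B).
  apply: le_trans (_ : _ <= `|complex.Re (\tr (herm_fun g A *m (A - B)))|) _.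
    exact: ler_norm.
  by rewrite -lecR; apply: le_trans hle; rewrite normc_ge_Re.
have <- : - complex.Re (\tr (herm_fun g A *m (B - A))) =
    complex.Re (\tr (herm_fun g A *m (A - B))).
  by rewrite -(opprB A B) mulmxN !raddfN opprK.
by move=> h1; move: hk h1; lra.
Qed.

End Eigenvalues.

(** * Monotonicity from left slopes, and derivatives of traces *)

(** The slope hypothesis says, without a limsup, that the left upper Dini derivative is nonpositive.
    A rise of [h] would survive subtracting a small linear function, whose tilted maximum then
    contradicts that hypothesis. *)
Lemma dini_nonincreasing (R : realType) (h : R -> R) (a b : R) :
  a <= b -> {within `[a, b], continuous h} ->
  (forall x e, x \in `]a, b[ -> 0 < e ->
     \forall y \near x^'-, h x - h y <= e * (x - y)) ->
  h b <= h a.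
Proof.
rewrite le_eqVlt => /predU1P[<-//|ab] ch hdini.
have [chi cha chb] := (continuous_within_itvP h ab).1 ch.
(* Interior points suffice: the value at [b] is the limit from the left. *)
suff hle x : x \in `]a, b[ -> h x <= h a.
  apply: (cvgr_to_le chb); near=> y; apply: hle.
  rewrite in_itv/=; apply/andP; split; near: y.
    exact: nbhs_left_gt.
  exact: nbhs_left_lt.
rewrite in_itv/= => /andP[ax xb]; rewrite leNgt; apply/negP => hax.
(* Half the mean slope of [h] on [[a, x]], so that [k] still rises, by [(h x - h a) / 2]. *)
pose e := (h x - h a) / (2 * (x - a)).
have e0 : 0 < e by rewrite divr_gt0 ?mulr_gt0 ?subr_gt0.
pose k y := h y - e * y.
have ck : {within `[a, x], continuous k}.
  move=> y; apply: cvgB.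
    have : {within `[a, x], continuous h}.
      apply: continuous_subspaceW ch; apply: subset_itvl.
      by rewrite bnd_simp ltW.
    exact.
  apply: continuous_subspaceT => z; exact: mulrl_continuous.
(* At a maximum of [k] beyond [a], [k] would be larger slightly to the left. *)
have [c] := EVT_max (ltW ax) ck.
rewrite in_itv/= => /andP[ac cx] cmax.
have kxa : k a < k x.
  rewrite /k -subr_gt0.
  have -> : h x - e * x - (h a - e * a) = (h x - h a) / 2.
    by rewrite /e; field; rewrite subr_eq0 gt_eqF.
  by rewrite divr_gt0// subr_gt0.
have kxc : k x <= k c by apply: cmax; rewrite in_itv/= lexx ltW.
have {}ac : a < c.
  by rewrite lt_neqAle ac andbT; apply: contraTneq kxc => <-; rewrite -ltNge.
have cab : c \in `]a, b[ by rewrite in_itv/= ac (le_lt_trans cx xb).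
(* The maximum forces left slopes of [h] at [c] to be at least [e]; bounding them by [e / 2] makes
   the contradiction strict. The case [c = x] is included, as only points to the left of [c] are
   used. *)
have e20 : 0 < e / 2 by rewrite divr_gt0.
have : \forall y \near c^'-, False.
  have H1 := hdini c _ cab e20.
  near=> y.
  have yc : y < c by near: y; exact: nbhs_left_lt.
  have ay : a < y by near: y; exact: nbhs_left_gt.
  have : k y <= k c.
    by apply: cmax; rewrite in_itv/= ltW//= ltW// (lt_le_trans yc).
  have : h c - h y <= e / 2 * (c - y) by near: y.
  rewrite /k; nra.
by move/filter_ex => [].
Unshelve. all: by end_near. Qed.

Lemma is_derive_left_slope_le (R : realType) (h : R -> R) (x l e : R) :
  is_derive x 1 h l -> l < e -> \forall y \near x^'-, h x - h y <= e * (x - y).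
Proof.
move=> [dh <-] le; have /nbhs_ballP[d /= d0 hd] : \forall k \near 0^',
  k^-1 *: ((h \o shift x) (k *: 1) - h x) < e by apply: cvgr_lt le.
near=> y.
have yx : y < x by near: y; exact: nbhs_left_lt.
have dy : x - d < y by near: y; apply: nbhs_left_gt; rewrite gtrBl.
have hb : ball 0 d (y - x).
  by rewrite /ball/= sub0r opprB gtr0_norm ?subr_gt0//; lra.
have := hd _ hb.
rewrite subr_eq0 (lt_eqF yx) => /(_ isT).
rewrite /shift/= [_ *: 1]mulr1 subrK.
rewrite -[_ *: _]/(_ * _) mulrC ltr_ndivrMr ?subr_lt0//.
by move/ltW; nra.
Unshelve. all: by end_near. Qed.

(** With [G] constant in time, the trace is a finite real linear combination of real and imaginary
    parts of entries of [W]; no eigenvalue is differentiated. *)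
Lemma is_derive_Re_mxtrace (R : realType) n (G : 'M[R[i]]_n)
    (W : R -> 'M[R[i]]_n) (t : R) : mx_derivable W t ->
  is_derive t 1 (fun s => complex.Re (\tr (G *m W s)))
    (complex.Re (\tr (G *m mx_derive W t))).
Proof.
move=> dW.
have trE (X : 'M[R[i]]_n) : complex.Re (\tr (G *m X)) = \sum_i \sum_j
    (complex.Re (G i j) * complex.Re (X j i) -
     complex.Im (G i j) * complex.Im (X j i)).
  rewrite raddf_sum; apply: eq_bigr => i _.
  rewrite mxE raddf_sum; apply: eq_bigr => j _.
  by case: (G i j) => a b; case: (X j i) => c d.
pose F i j : R -> R :=
  complex.Re (G i j) \*: (fun s => complex.Re (W s j i) : R)
  - complex.Im (G i j) \*: (fun s => complex.Im (W s j i) : R).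
have -> : (fun s => complex.Re (\tr (G *m W s))) = \sum_i \sum_j F i j.
  apply/funext => s; rewrite trE fct_sumE; apply: eq_bigr => i _.
  by rewrite fct_sumE.
rewrite trE; apply: is_derive_sum => i; apply: is_derive_sum => j.
have [dR dI] := dW j i.
rewrite !mxE /= !derive1E.
by apply: is_deriveB; apply: is_deriveZ;
  [exact: derivableP dR|exact: derivableP dI].
Qed.

(** * Continuity of the trace functional along a curve *)

Section Continuity.
Variables (R : realType) (n : nat).
Implicit Types (X Y : 'M[R[i]]_n).

Lemma le_norm1D X Y : norm1 (X + Y) <= norm1 X + norm1 Y.
Proof.
rewrite /norm1 -big_split/=; apply: ler_sum => i _.
rewrite -big_split/=; apply: ler_sum => j _.
by rewrite mxE -lecR rmorphD !Re_normE ler_normD.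
Qed.

Lemma norm1N X : norm1 (- X) = norm1 X.
Proof.
by apply: eq_bigr => i _; apply: eq_bigr => j _; rewrite mxE normrN.
Qed.

Lemma norm1Zi X : norm1 ('i%C *: X) = norm1 X.
Proof.
apply: eq_bigr => i _; apply: eq_bigr => j _.
have ni : `|'i%C| = 1 :> R[i].
  by rewrite normc_def/= expr0n/= expr1n add0r sqrtr1.
by rewrite mxE normrM ni mul1r.
Qed.

Lemma norm1_le_ReIm X : norm1 X <=
  \sum_i \sum_j (`|complex.Re (X i j)| + `|complex.Im (X i j)|).
Proof.
apply: ler_sum => i _; apply: ler_sum => j _.
case: (X i j) => a b; rewrite normc_def/=.
rewrite -[leRHS]ger0_norm ?addr_ge0// -sqrtr_sqr ler_sqrt ?sqr_ge0//.
rewrite sqrrD !real_normK ?num_real// lerD2r lerDl mulrn_wge0// mulr_ge0//.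
Qed.

Lemma mx_continuous_within_norm1 (D : set R) (W : R -> 'M[R[i]]_n) x :
  mx_continuous_within D W -> D x ->
  norm1 (W s - W x) @[s --> within D (nbhs x)] --> 0.
Proof.
move=> cW Dx.
pose d s : R := \sum_i \sum_j (`|complex.Re (W s i j) - complex.Re (W x i j)|
  + `|complex.Im (W s i j) - complex.Im (W x i j)|).
apply: (@squeeze_cvgr _ _ _ _ (cst 0) d).
- near=> s; apply/andP; split; last first.
    have -> : d s = \sum_i \sum_j
        (`|complex.Re ((W s - W x) i j)| + `|complex.Im ((W s - W x) i j)|).
      by apply: eq_bigr => i _; apply: eq_bigr => j _; rewrite !mxE !raddfB.
    exact: norm1_le_ReIm.
  by do 2 (apply: sumr_ge0 => ? _); rewrite -ler0c Re_normE.
- exact: cvg_cst.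
have -> : (0 : R) = \sum_(i < n) \sum_(j < n) (`|0 : R| + `|0 : R|).
  by rewrite big1// => i _; rewrite big1// => j _; rewrite normr0 addr0.
apply: cvg_big => [|i _]; first exact: add_continuous.
apply: cvg_big => [|j _]; first exact: add_continuous.
have [/subspace_continuousP/(_ x Dx) cR
  /subspace_continuousP/(_ x Dx) cI] := cW i j.
have sub0 (u : R -> R) : u @ within D (nbhs x) --> u x ->
    `|u s - u x| @[s --> within D (nbhs x)] --> `|0 : R|.
  move=> cu; apply: cvg_norm; rewrite -[X in _ --> X](subrr (u x)).
  by apply: cvgB => //; exact: cvg_cst.
apply: cvgD; [exact: sub0 cR|exact: sub0 cI].
Unshelve. all: by end_near. Qed.

End Continuity.

Lemma trfun_continuous_within (R : realType) n (f g : R -> R) (D : set R)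
    (W : R -> 'M[R[i]]_n) : subgradient f g -> mx_continuous_within D W ->
  (forall s, D s -> 'i%C *: W s \is hermsymmx) ->
  {within D, continuous (fun s => trfun f ('i%C *: W s) : R)}.
Proof.
move=> fg cW hW; apply/subspace_continuousP => x Dx.
have W0 := mx_continuous_within_norm1 cW Dx.
(* [M] bounds the spectrum of ['i%C *: W s] as soon as [W s] is within distance 1 of [W x], so [K]
   is a Lipschitz constant valid at both points. *)
pose M := norm1 (W x) + 1; pose K := n%:R * (`|g (- M)| + `|g M|).
have K0 : 0 <= K by rewrite mulr_ge0// addr_ge0.
apply/cvgrPdist_le => e e0.
(* [K] may be zero, hence the denominator [K + 1]. *)
have eK0 : 0 < e / (K + 1) by rewrite divr_gt0// ltr_wpDl.
have W1 : \forall s \near within D (nbhs x), norm1 (W s - W x) <= 1.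
  exact: (cvgr_le _ W0 _ ltr01).
have We : \forall s \near within D (nbhs x), norm1 (W s - W x) <= e / (K + 1).
  exact: (cvgr_le _ W0 _ eK0).
near=> s.
have Ds : D s by near: s; exact: withinT.
have hK y : D y -> norm1 (W y) <= M ->
    forall i, `|g (eigval ('i%C *: W y) i)| <= `|g (- M)| + `|g M|.
  move=> Dy hy i; apply: subgradient_bounded fg _.
  by apply: le_trans (eigval_le_norm1 i (hW y Dy)) _; rewrite norm1Zi.
have hx : norm1 (W x) <= M by rewrite lerDl.
have hs : norm1 (W s) <= M.
  rewrite -[W s](subrK (W x)) addrC; apply: le_trans (le_norm1D _ _) _.
  by rewrite lerD2l; near: s.
have h1 := trfun_le fg (hK x Dx hx) (hW x Dx) (hW s Ds).
have h2 := trfun_le fg (hK s Ds hs) (hW s Ds) (hW x Dx).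
have hKe : K * norm1 (W s - W x) <= e.
  apply: (@le_trans _ _ (K * (e / (K + 1)))).
    by apply: ler_wpM2l => //; near: s.
  by rewrite mulrCA ler_piMr ?(ltW e0)// ler_pdivrMr ?ltr_wpDl// mul1r lerDl.
move: h1 h2; rewrite -!scalerBr !norm1Zi -/K.
rewrite -(opprB (W s) (W x)) norm1N => h1 h2.
by rewrite /from_subspace ler_norml lerNl opprB
  (le_trans h1 hKe) (le_trans h2 hKe).
Unshelve. all: by end_near. Qed.

(** * Decay along the Euler--Zeitlin flow *)

Lemma hermsymmx_Zi (R : realType) n (A : 'M[R[i]]_n) :
  in_u A -> 'i%C *: A \is hermsymmx.
Proof.
move=> /is_hermitianmxP; rewrite expr1 scaleN1r => hA.
apply/is_hermitianmxP; rewrite expr0 scale1r.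
apply/matrixP => i j; have /matrixP/(_ i j) := hA; rewrite !mxE => ->.
by rewrite rmorphM mulrN -mulNr; congr (_ * _); apply/eqP;
  rewrite eq_complex /= oppr0 !eqxx.
Qed.

(** For [k = kappa / hbar^2] and [l = 1 / hbar] the second factor is the velocity of the solution.
    Its transport part has zero trace against [G], and its dissipative part has a sign because [g]
    is monotone. *)
Lemma mxtrace_flow_le0 (R : realType) n (g : R -> R) (k l : R)
    (X Q : 'M[R[i]]_n) :
  (forall x y, 0 <= (g x - g y) * (x - y)) -> 0 <= k -> in_u X -> in_u Q ->
  complex.Re (\tr (('i%C *: herm_fun g ('i%C *: X)) *m
    (k%:C *: bracket (bracket X Q) Q - l%:C *: bracket X Q))) <= 0.
Proof.
move=> hg k0 /hermsymmx_Zi hX hQ.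
have le0 := mxtrace_herm_double_bracket_le0 hg hX hQ.
have := mxtrace_mul_double_bracketB k%:C l%:C Q (herm_fun_comm g hX).
move: (herm_fun g _) le0 => G le0 ->.
by case: (\tr _) le0 => u v /= u0; rewrite mul0r subr0 mulr_ge0_le0.
Qed.

Theorem proposition5p2 (R : realType) (N : nat) (hN : (2 <= N)%N)
    (kappa : R) (hkappa : 0 <= kappa)
    (f : R -> R) (hf : convex_function (E := R^o) setT f)
    (S : 'I_3 -> 'M[R[i]]_N) (hS : so3_irrep S)
    (J : interval R) (W P : R -> 'M[R[i]]_N)
    (hWP : euler_zeitlin_solution S kappa J W P) :
  forall s t : R, s \in J -> t \in J -> s <= t ->
    casimir f (W t) <= casimir f (W s).
Proof.
move=> a b aJ bJ ab.
have [g fg] := convex_subgradient hf.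
have [hJ cW dW] := hWP.
have hW s : s \in J -> 'i%C *: W s \is hermsymmx.
  by move=> /hJ[[Wu _] _ _]; exact: hermsymmx_Zi.
rewrite /casimir !mxtrace_herm_fun -!rmorphM lecR.
apply: ler_wpM2l; first by rewrite divr_ge0// mulr_ge0// pi_ge0.
have abJ x : x \in `[a, b] -> x \in J by exact: interval_is_interval.
apply: (dini_nonincreasing ab (h := fun s => trfun f ('i%C *: W s))).
  apply: trfun_continuous_within fg _ _; last by move=> s /= /abJ; exact: hW.
  by move=> i j; have [cR cI] := cW i j; split; [move: cR|move: cI];
     apply: continuous_subspaceW => x /= /abJ.
move=> x e xab e0.
have xJ : x \in J by apply: abJ; exact: subset_itv_oo_cc xab.
(* The open interval between [a] and [b] lies in the interior of [J], where the differential
   equation holds. *)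
have [|dWx eqx] := dW x.
  rewrite /interior /=; apply: filterS (near_in_itvoo xab) => y yab.
  by apply: abJ; exact: subset_itv_oo_cc yab.
have [[Wu _] [Pu _] _] := hJ x xJ.
set A := 'i%C *: W x; pose G := herm_fun g A.
have hA : A \is hermsymmx by exact: hW.
(* [G] is frozen at time [x], and the factor ['i%C] is placed on it so that the derivative of [W]
   itself appears. *)
have := is_derive_Re_mxtrace ('i%C *: G) dWx.
have -> : mx_derive W x =
    (kappa / hbar R N ^+ 2)%:C *: bracket (bracket (W x) (P x)) (P x)
    - ((hbar R N)^-1)%:C *: bracket (W x) (P x).
  by rewrite -eqx addrK.
move=> dG.
have k0 : 0 <= kappa / hbar R N ^+ 2 by rewrite divr_ge0// sqr_ge0.
have le0 := mxtrace_flow_le0 (hbar R N)^-1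
  (fun x y => subgradient_nondecreasing x y fg) k0 Wu Pu.
have := is_derive_left_slope_le dG (le_lt_trans le0 e0).
have nxl : \forall y \near x^'-, a < y.
  by apply: nbhs_left_gt; move: xab; rewrite in_itv/= => /andP[].
move=> slope; near=> y.
have yJ : y \in J.
  apply: abJ; rewrite in_itv/=; apply/andP; split; first by apply: ltW; near: y.
  move: xab; rewrite in_itv/= => /andP[_ xb]; apply: le_trans (ltW xb).
  by apply: ltW; near: y; exact: nbhs_left_lt.
(* Klein's inequality between times [x] and [y] bounds the decrement of the Casimir by that of the
   linear function [s |-> Re tr(iG W(s))], whose left slope is already controlled. *)
have hk := klein fg hA (hW y yJ).
have sl : complex.Re (\tr ('i%C *: G *m W x)) -
    complex.Re (\tr ('i%C *: G *m W y))
    <= e * (x - y) by near: y.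
apply: le_trans sl; rewrite lerBlDr -lerBlDl opprB.
by move: hk; rewrite mxtrace_mulZB raddfB.
Unshelve. all: by end_near. Qed.
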